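(* Let $\Gamma$ be a countable amenable group acting (on the left) by homeomorphisms on a compact metric space $X$, and let $S \subset \Gamma$ be a subsemigroup of $\Gamma$ with $1_\Gamma \notin S$. Suppose that every $f \in C(X)$ is contained in the closed algebra generated by $\{f \circ s : s \in S\}$ and the constant functions. Then the action of $\Gamma$ on $X$ has zero topological entropy.
   Context: $C(X)$ is the Banach algebra of continuous real-valued functions on $X$ with the supremum norm, and ''closed algebra generated by'' a set means the smallest norm-closed subalgebra containing it. For $s\in\Gamma$, $f\circ s$ is the function $x \mapsto f(s x)$. The topological entropy is the usual topological entropy of an action of a countable amenable group on a compact metric space (defined via open covers and a F&oslash;lner sequence, i.e. a sequence $(F_i)$ of nonempty finite subsets of $\Gamma$ with $|gF_i\setminus F_i|/|F_i|\to 0$ for all $g \in \Gamma$, where for an open cover $\mathcal U$ one uses the joins $\bigvee_{g\in F_i} g^{-1}\mathcal U$). *)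

(* Defs.v *)
From HB Require Import structures.
From mathcomp Require Import all_boot all_order all_algebra.
From mathcomp Require Import finmap.
From mathcomp Require Import all_classical all_reals all_analysis.

Set Implicit Arguments.
Unset Strict Implicit.
Unset Printing Implicit Defensive.

Import Order.TTheory GRing.Theory Num.Theory.
Import numFieldNormedType.Exports.

Local Open Scope classical_set_scope.
Local Open Scope ring_scope.

Section groups.
Context {R : realType} {G : groupType}.

Definition subsemigroup (S : set G) : Prop :=
  forall s t, S s -> S t -> S (s * t)%g.

Definition folner (F : nat -> {fset G}) : Prop :=
  (forall n, F n != fset0) /\
  (forall g : G,
    (#|` ([fset (g * x)%g | x in F n] `\` F n)%fset|%:R / #|` F n|%:R : R)
      @[n --> \oo] --> (0 : R)).

End groups.

(* For a countable group this is equivalent to the existence of an invariant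
   mean. The real field R is only where the ratios of the Folner condition
   live. *)
Definition amenable (R : realType) (G : groupType) : Prop :=
  exists F : nat -> {fset G}, folner (R := R) F.

Section actions.
Context {G : groupType} {X : topologicalType}.

Definition homeomorphism (f : X -> X) : Prop :=
  exists f' : X -> X,
    [/\ cancel f f', cancel f' f, continuous f & continuous f'].

Definition action_by_homeomorphisms (act : G -> X -> X) : Prop :=
  [/\ forall x, act 1%g x = x,
      forall g h x, act (g * h)%g x = act g (act h x)
    & forall g, homeomorphism (act g)].

End actions.

Section function_algebras.
Context {R : realType} {X : topologicalType}.
Implicit Types (A B : set (X -> R)) (f g : X -> R).

Definition sup_norm f : R := sup [set `|f x| | x in [set: X]].

(* A subalgebra is not required to contain the constant function 1. *)
Definition subalgebra A : Prop :=
  [/\ A (cst 0),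
      forall f g, A f -> A g -> A (f \+ g),
      forall (c : R) f, A f -> A (c \*o f)
    & forall f g, A f -> A g -> A (f \* g)].

Definition sup_norm_closed A : Prop :=
  forall f, continuous f ->
    (forall e : R, 0 < e -> exists2 g, A g & sup_norm (f \- g) < e) -> A f.

Definition closed_subalgebra A : Prop :=
  [/\ A `<=` [set f | continuous f], subalgebra A & sup_norm_closed A].

Definition closed_algebra_generated B : set (X -> R) :=
  smallest closed_subalgebra B.

End function_algebras.

Section entropy.
Context {R : realType} {G : groupType} {X : topologicalType}.
Variable act : G -> X -> X.
Implicit Types (U : set (set X)) (F : nat -> {fset G}).

Definition open_cover U : Prop :=
  U `<=` open /\ cover U id = [set: X].

(* The join over g in E of the covers g^-1 U: its members are the
   intersections over g in E of the sets g^-1 (V g), with every V g in U. *)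
Definition cover_join (E : {fset G}) U : set (set X) :=
  [set W | exists2 V : G -> set X,
    (forall g, g \in E -> U (V g)) &
    W = \bigcap_(g in [set` E]) (act g @^-1` V g)].

(* Least cardinality of a finite subcover; the infimum is a minimum as soon as
   U has a finite subcover, in particular for open covers of a compact space. *)
Definition cover_number U : R :=
  inf [set #|` V|%:R | V in
    [set V : {fset (set X)} | [set` V] `<=` U /\ cover [set` V] id = [set: X]]].

(* For an open cover of a compact space and a Folner sequence F the limit
   exists (Ornstein-Weiss), so that the limit superior is the limit. *)
Definition cover_entropy F U : \bar R :=
  limn_esup (fun n =>
    (ln (cover_number (cover_join (F n) U)) / #|` F n|%:R)%:E).

Definition topological_entropy F : \bar R :=
  ereal_sup [set cover_entropy F U | U in [set U | open_cover U]].

End entropy.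

(* Main.v *)
(* Let h : X -> [0, 1] be continuous; it suffices to code the orbits (g x), g in
   F_n, by exp(o(|F_n|)) symbols so that the code tells h (g x) = 0 from
   h (g x) = 1.  Replace h by f = phi o h for a Cantor function phi.  At stage k,
   f takes a value in Z / 2^k except on a set B_k, for which there are 4^k disjoint
   candidates; hence, given x and n, one of the candidates satisfies
   |{g in F_n : g x in B_k}| <= |F_n| / 4^k.
   By hypothesis f x is known up to 2^-m from the f (s x), s in a finite T
   included in S.  Since S is a semigroup without 1, multiplication by T is
   acyclic on F_n, so f (g x) can be predicted from the f (s g x), s in T, unless
   s g leaves F_n, g x is in B_m or s g x is in B_M.  The unpredicted values are
   recorded with a cost 2 k at stage k <= M; for M large this costs
   O(2^-m |F_n|) in total.  As M depends on f, hence on the whole sequence of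
   candidates chosen, a König-type argument is used to see that finitely many
   finite sequences of choices suffice. *)

Require Import Defs.
From HB Require Import structures.
From mathcomp Require Import all_boot all_order all_algebra.
From mathcomp Require Import finmap.
From mathcomp Require Import all_classical all_reals all_analysis.
From mathcomp Require Import ring lra zify.

Set Implicit Arguments.
Unset Strict Implicit.
Unset Printing Implicit Defensive.

Import Order.TTheory GRing.Theory Num.Theory.
Import numFieldNormedType.Exports.

Local Open Scope classical_set_scope.
Local Open Scope ring_scope.

(** * Cantor functions *)

Section cantor.
Context {R : realType}.
Implicit Types (x y z t : R) (w : nat -> nat) (j k n L N : nat).

Definition clip t : R := Num.max 0 (Num.min 1 t).

Lemma clip_ge0 t : 0 <= clip t.
Proof. by rewrite le_max lexx. Qed.

Lemma clip_le1 t : clip t <= 1.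
Proof. by rewrite ge_max ler01 ge_min lexx. Qed.

Lemma clip_eq0 t : t <= 0 -> clip t = 0.
Proof. by move=> t0; apply: max_l; rewrite ge_min t0 orbT. Qed.

Lemma clip_eq1 t : 1 <= t -> clip t = 1.
Proof. by move=> t1; rewrite /clip min_l// max_r. Qed.

Lemma continuous_clip (T : topologicalType) (f : T -> R) :
  continuous f -> continuous (fun u => clip (f u)).
Proof.
move=> fc x.
apply: (@continuous_max R T (cst 0) (fun u => Num.min 1 (f u))).
  exact: cst_continuous.
apply: (@continuous_min R T (cst 1) f); last exact: fc.
exact: cst_continuous.
Qed.

(* On each [n, n + 1] with n < N the staircase climbs from n to n + 1, and does
   so only on the j-th of the L subintervals of length 1 / L. *)
Definition stair L j N z : R := \sum_(n < N) clip (L%:R * (z - n%:R) - j%:R).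

Lemma stair_ge0 L j N z : 0 <= stair L j N z.
Proof. by apply: sumr_ge0 => n _; exact: clip_ge0. Qed.

Lemma stair_le L j N z : stair L j N z <= N%:R.
Proof.
rewrite -[in leRHS](card_ord N) -sum1_card natr_sum.
by apply: ler_sum => n _; exact: clip_le1.
Qed.

Lemma stair_ge L j N z : (j < L)%N -> N%:R <= z -> stair L j N z = N%:R.
Proof.
move=> jL Nz; rewrite -[in RHS](card_ord N) -sum1_card natr_sum.
apply: eq_bigr => n _; apply: clip_eq1.
have nN : n.+1%:R <= N%:R :> R by rewrite ler_nat.
have jL' : j.+1%:R <= L%:R :> R by rewrite ler_nat.
have zn : 1 <= z - n%:R by rewrite -natr1 in nN; lra.
have : L%:R <= L%:R * (z - n%:R) by rewrite ler_peMr// ler0n.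
rewrite -natr1 in jL'; lra.
Qed.

Lemma stair_dist L j N z : (j < L)%N -> 0 <= z <= N%:R ->
  `|stair L j N z - z| <= 1.
Proof.
move=> jL; elim: N => [|N IH] /andP[z0 zN].
  have -> : z = 0 by apply/eqP; rewrite eq_le z0 andbT.
  by rewrite /stair big_ord0 subr0 normr0.
rewrite /stair big_ord_recr /=.
have [zN'|Nz] := leP z N%:R.
  rewrite clip_eq0 ?addr0; first by apply: IH; rewrite z0 zN'.
  rewrite subr_le0 (le_trans (y := 0))//.
  by rewrite mulr_ge0_le0// subr_le0.
rewrite -/(stair L j N z) (stair_ge jL (ltW Nz)).
have := clip_ge0 (L%:R * (z - N%:R) - j%:R).
have := clip_le1 (L%:R * (z - N%:R) - j%:R).
rewrite -natr1 in zN; rewrite ler_norml; lra.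
Qed.

Lemma stair_nat L j N n : (j < L)%N -> (n <= N)%N -> stair L j N n%:R = n%:R.
Proof.
move=> jL; elim: N => [|N IH].
  by rewrite leqn0 => /eqP ->; rewrite /stair big_ord0.
rewrite leq_eqVlt => /predU1P[->|]; first exact: stair_ge.
rewrite ltnS => nN; rewrite /stair big_ord_recr /= -/(stair L j N n%:R) IH//.
rewrite clip_eq0 ?addr0//.
rewrite subr_le0 (le_trans (y := 0))//.
by rewrite mulr_ge0_le0// subr_le0 ler_nat.
Qed.

Lemma stair_nnat L j N z : stair L j N z \isn't a Num.nat ->
  exists n, (L * n + j)%:R < L%:R * z < (L * n + j).+1%:R.
Proof.
apply: contraNP => nE; apply: rpred_sum => n _.
have [t0|t0] := leP (L%:R * (z - n%:R) - j%:R) 0.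
  by rewrite clip_eq0// rpred0.
have [t1|t1] := leP 1 (L%:R * (z - n%:R) - j%:R).
  by rewrite clip_eq1// rpred1.
exfalso; apply: nE; exists n; rewrite -natr1 natrD natrM; lra.
Qed.

(** Both choices put [L z] in an open unit interval with integer ends; these two intervals meet, so
    they coincide, and the left end determines [j] modulo [L]. *)
Lemma stair_inj L j j' N z : (j < L)%N -> (j' < L)%N ->
  stair L j N z \isn't a Num.nat -> stair L j' N z \isn't a Num.nat -> j = j'.
Proof.
move=> jL j'L /stair_nnat[n /andP[n1 n2]] /stair_nnat[n' /andP[n1' n2']].
have e : (L * n + j)%N = (L * n' + j')%N.
  apply/eqP; rewrite eqn_leq; apply/andP.
  by split; rewrite -ltnS -(ltr_nat R); 
    [exact: lt_trans n2' | exact: lt_trans n2].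
have := congr1 (modn ^~ L) e.
by rewrite ![(L * _)%N]mulnC !modnMDl !modn_small.
Qed.

Lemma continuous_stair L j N (T : topologicalType) (f : T -> R) :
  continuous f -> continuous (fun u => stair L j N (f u)).
Proof.
move=> fc; rewrite /stair; elim: N => [|N IH] u.
  by under eq_fun do rewrite big_ord0; exact: cvg_cst.
under eq_fun do rewrite big_ord_recr/=.
apply: cvgD; first exact: IH.
have tc : continuous (fun v => L%:R * (f v - N%:R) - j%:R).
  move=> v; apply: cvgB; last exact: cvg_cst.
  by apply: cvgMr; apply: cvgB; [exact: fc | exact: cvg_cst].
exact: continuous_clip tc u.
Qed.

(* The limit of [level w k / 2 ^ k] is a Cantor function.  The choices [w] place
   the intervals on which the k-th approximation is not locally constant. *)
Fixpoint level w k z : R :=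
  if k is k'.+1 then stair (4 ^ k) (w k') (2 ^ k) (2 * level w k' z) else z.

Definition admissible w := forall k, (w k < 4 ^ k.+1)%N.

Lemma eq_level w w' k z : (forall i, (i < k)%N -> w i = w' i) ->
  level w k z = level w' k z.
Proof.
elim: k => //= k IH e; rewrite IH ?e// => i ik; apply: e; exact: ltnW.
Qed.

Lemma continuous_level w k (T : topologicalType) (f : T -> R) :
  continuous f -> continuous (fun u => level w k (f u)).
Proof.
move=> fc; elim: k => //= k IH; apply: continuous_stair => x.
by apply: cvgMr; exact: IH.
Qed.

Lemma level_ge0 w k z : 0 <= z -> 0 <= level w k z.
Proof. by case: k => //= k _; exact: stair_ge0. Qed.

Lemma level_le w k z : z <= 1 -> level w k z <= 2 ^+ k.
Proof. by case: k => //= k _; rewrite -natrX; exact: stair_le. Qed.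

Lemma level_step w k z : admissible w -> 0 <= z <= 1 ->
  `|level w k.+1 z - 2 * level w k z| <= 1.
Proof.
move=> wa /andP[z0 z1]; apply: stair_dist => //.
rewrite natrX mulr_ge0 ?level_ge0//= exprS ler_pM2l//; exact: level_le.
Qed.

Lemma level_natS w k z : admissible w -> z <= 1 ->
  level w k z \is a Num.nat -> level w k.+1 z = 2 * level w k z.
Proof.
move=> wa z1 /natrP[n e] /=; rewrite e -natrM stair_nat//.
by rewrite -(ler_nat R) natrM -e natrX exprS ler_pM2l//; exact: level_le.
Qed.

Lemma level_nat w k k' z : admissible w -> z <= 1 -> (k <= k')%N ->
  level w k z \is a Num.nat -> level w k' z \is a Num.nat.
Proof.
move=> wa z1 /subnK<- kn; elim: (k' - k)%N => // d IH.
by rewrite addSn level_natS// rpredM// natr_nat.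
Qed.

(* The sets on which [level _ k.+1] is not an integer are disjoint for different
   choices at stage k. *)
Lemma level_inj w w' k z : (forall i, (i < k)%N -> w i = w' i) ->
  (w k < 4 ^ k.+1)%N -> (w' k < 4 ^ k.+1)%N ->
  level w k.+1 z \isn't a Num.nat -> level w' k.+1 z \isn't a Num.nat ->
  w k = w' k.
Proof. by move=> e wk w'k /=; rewrite (eq_level z e); exact: stair_inj. Qed.

(** These are the left ends of the intervals of radius [2 ^- k] about [level w k z / 2 ^ k]; for
    admissible [w] and [z] in [0, 1] the intervals are nested, so the supremum is the limit. *)
Definition cantor w z : R :=
  sup [set (level w k z - 1) / 2 ^+ k | k in [set: nat]].

(** By [level_step] the centre moves from one stage to the next by at most the amount by which the
    radius shrinks. *)
Lemma level_cauchy w k d z : admissible w -> 0 <= z <= 1 ->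
  (level w k z - 1) / 2 ^+ k <= (level w (k + d) z - 1) / 2 ^+ (k + d) /\
  (level w (k + d) z + 1) / 2 ^+ (k + d) <= (level w k z + 1) / 2 ^+ k.
Proof.
move=> wa z01; elim: d => [|d [IH1 IH2]]; first by rewrite addn0.
rewrite addnS; have := level_step (k + d) wa z01.
move: IH1 IH2; set a := level w (k + d) z; set b := level w (k + d).+1 z.
set p := 2 ^+ (k + d) => IH1 IH2.
have p0 : 0 < p by rewrite exprn_gt0.
rewrite ler_norml => ab; split.
  apply: (le_trans IH1); rewrite exprS -/p ler_pdivrMr//.
  rewrite (_ : (b - 1) / (2 * p) * p = (b - 1) / 2); last by field; lra.
  lra.
apply: le_trans IH2; rewrite exprS -/p ler_pdivlMr//.
rewrite (_ : (b + 1) / (2 * p) * p = (b + 1) / 2); last by field; lra.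
lra.
Qed.

Lemma cantor_bounds w k z : admissible w -> 0 <= z <= 1 ->
  (level w k z - 1) / 2 ^+ k <= cantor w z <= (level w k z + 1) / 2 ^+ k.
Proof.
move=> wa z01.
have ub : ubound [set (level w k z - 1) / 2 ^+ k | k in [set: nat]]
    ((level w k z + 1) / 2 ^+ k).
  move=> _ [k' _ <-].
  have mid a n : (a - 1) / 2 ^+ n <= (a + 1) / 2 ^+ n :> R.
    by rewrite ler_pM2r ?invr_gt0 ?exprn_gt0//; lra.
  have [/subnKC<-|/ltnW/subnKC<-] := leqP k k'.
    have [_] := level_cauchy k (k' - k) wa z01; apply: le_trans; exact: mid.
  have [+ _] := level_cauchy k' (k - k') wa z01; move=> /le_trans; apply.
  exact: mid.
apply/andP; split; last first.
  by apply: ge_sup => //; exists ((level w 0 z - 1) / 2 ^+ 0), 0%N.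
by apply: ub_le_sup; [eexists; exact: ub | exists k].
Qed.

Lemma cantor_dist w k z : admissible w -> 0 <= z <= 1 ->
  `|cantor w z - level w k z / 2 ^+ k| <= 2 ^- k.
Proof.
move=> wa z01; have := cantor_bounds k wa z01.
by rewrite ler_norml !mulrDl mulN1r mul1r; lra.
Qed.

Lemma level_natD w k d z : admissible w -> z <= 1 ->
  level w k z \is a Num.nat ->
  level w (k + d) z / 2 ^+ (k + d) = level w k z / 2 ^+ k.
Proof.
move=> wa z1 kn; elim: d => [|d IH]; first by rewrite addn0.
rewrite addnS level_natS//; last by apply: level_nat kn => //; exact: leq_addr.
rewrite exprS -IH; have : 2 ^+ (k + d) != 0 :> R by rewrite expf_neq0.
by move=> ?; field.
Qed.

Lemma invexp2_lt (e : R) : 0 < e -> exists k, 2 ^- k < e.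
Proof.
move=> e0; have /cvgrPdist_lt/(_ _ e0)[k _ /(_ k (leqnn k))] :
    (2^-1 : R) ^+ n @[n --> \oo] --> 0.
  by apply: cvg_expr; rewrite gtr0_norm ?invr_gt0// invf_lt1// ltr1n.
rewrite /= sub0r normrN gtr0_norm ?exprn_gt0 ?invr_gt0// exprVn => ke.
by exists k.
Qed.

(** From an integer level on, each level is twice the previous one, so the quotients by [2 ^ k] no
    longer change. *)
Lemma cantorE w k z : admissible w -> 0 <= z <= 1 ->
  level w k z \is a Num.nat -> cantor w z = level w k z / 2 ^+ k.
Proof.
move=> wa z01 kn; apply/eqP; rewrite -subr_eq0 -normr_le0 leNgt.
apply/negP => /invexp2_lt[d]; apply/negP; rewrite -leNgt.
have := cantor_dist (k + d) wa z01.
rewrite level_natD//; last by case/andP: z01.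
move=> /le_trans; apply; rewrite lef_pV2 ?posrE ?exprn_gt0//.
by rewrite ler_weXn2l ?leq_addl// ler1n.
Qed.

Lemma cantor0 w : admissible w -> cantor w 0 = 0.
Proof.
move=> wa; rewrite (@cantorE w 0)//= ?lexx ?ler01 ?rpred0//.
by rewrite mul0r.
Qed.

Lemma cantor1 w : admissible w -> cantor w 1 = 1.
Proof.
move=> wa; rewrite (@cantorE w 0)//= ?lexx ?ler01 ?rpred1//.
by rewrite expr0 divr1.
Qed.

Lemma continuous_cantor w (T : topologicalType) (f : T -> R) :
  admissible w -> (forall u, 0 <= f u <= 1) -> continuous f ->
  continuous (cantor w \o f).
Proof.
move=> wa f01 fc u; apply/cvgrPdist_lt => e e0.
have [k ke] : exists k, 2 ^- k < e / 4 by apply: invexp2_lt; lra.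
have /cvgrPdist_lt/(_ (e / 4)) : (level w k (f v) / 2 ^+ k) @[v --> u] -->
    level w k (f u) / 2 ^+ k.
  apply: cvgMl; exact: continuous_level.
have e4 : 0 < e / 4 by lra.
move=> /(_ e4); apply: filterS => v /=.
have := cantor_dist k wa (f01 u); have := cantor_dist k wa (f01 v).
rewrite !ler_norml !ltr_norml; lra.
Qed.

End cantor.

(** * Prediction by finitely many translates *)

Section prediction.
Context {R : realType} {X : topologicalType}.

Lemma continuous_bounded (f : X -> R) : compact [set: X] -> continuous f ->
  exists2 M : R, 0 <= M & forall x, `|f x| <= M.
Proof.
move=> Xc fc.
have : compact (f @` setT).
  by apply: continuous_compact => //; exact: continuous_subspaceT.
move=> /compact_bounded[N [_ /(_ (`|N| + 1))hN]].
exists (`|N| + 1) => [|x]; first by rewrite ltW// ltr_wpDl.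
by apply: hN; [rewrite (le_lt_trans (ler_norm N))// ltrDl | exists x].
Qed.

Lemma le_sup_norm (f : X -> R) x : compact [set: X] -> continuous f ->
  `|f x| <= sup_norm f.
Proof.
move=> Xc fc; have [M _ hM] := continuous_bounded Xc fc.
have ub : has_ubound [set `|f x| | x in [set: X]] by exists M => _ [y _ <-].
by apply: (ub_le_sup ub); exists x.
Qed.

Variables (G : groupType) (act : G -> X -> X) (S : set G).

(** The functions known up to any error from finitely many values [f (s x)] form a closed subalgebra
    [D] containing the generators. *)
Lemma finite_prediction (f h : X -> R) (e : R) :
  compact [set: X] -> (forall g, continuous (act g)) -> continuous f ->
  closed_algebra_generated
      ([set f \o act s | s in S] `|` [set cst c | c in [set: R]]) h ->
  0 < e ->
  exists2 T : {fset G}, (forall s, s \in T -> S s) &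
    forall x y, (forall s, s \in T -> f (act s x) = f (act s y)) ->
      `|h x - h y| < e.
Proof.
move=> Xc actc fc hA e0.
pose P (T : {fset G}) x y := forall s, s \in T -> f (act s x) = f (act s y).
pose D : set (X -> R) := [set h | continuous h /\ forall e, 0 < e ->
  exists2 T : {fset G}, (forall s, s \in T -> S s) &
    forall x y, P T x y -> `|h x - h y| < e].
suff : D h by case=> _ /(_ e e0).
have PU T1 T2 x y : P (T1 `|` T2)%fset x y -> P T1 x y /\ P T2 x y.
  by move=> p; split=> s sT; apply: p; rewrite inE sT ?orbT.
apply: smallest_sub hA; last first.
  move=> _ [[s Ss <-]|[c _ <-]]; split.
  - by move=> x; apply: continuous_comp; [exact: actc | exact: fc].
  - move=> d d0; exists [fset s]%fset => [t|x y /(_ s)].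
      by rewrite inE => /eqP->.
    by rewrite inE eqxx /= => ->//; rewrite subrr normr0.
  - exact: cst_continuous.
  - by move=> d d0; exists fset0 => [//|x y _]; rewrite subrr normr0.
split; first by move=> k [].
- split.
  + split; first exact: cst_continuous.
    by move=> d d0; exists fset0 => [//|x y _]; rewrite subrr normr0.
  + move=> k l [kc kD] [lc lD]; split=> [x|d d0].
      exact: cvgD (kc x) (lc x).
    have d2 : 0 < d / 2 by lra.
    have [T1 T1S T1P] := kD _ d2; have [T2 T2S T2P] := lD _ d2.
    exists (T1 `|` T2)%fset => [s|x y /PU[/T1P + /T2P]] /=.
      by rewrite inE => /orP[/T1S|/T2S].
    by rewrite !ltr_norml; lra.
  + move=> c k [kc kD]; split=> [x|d d0]; first exact: cvgMr (kc x).
    have c1 : 0 < `|c| + 1 by rewrite ltr_wpDl.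
    have [T TS TP] := kD (d / (`|c| + 1)) (divr_gt0 d0 c1).
    exists T => // x y /TP; rewrite /= -mulrBr normrM ltr_pdivlMr// mulrC.
    by apply: le_lt_trans; rewrite ler_wpM2r// lerDl.
  + move=> k l [kc kD] [lc lD]; split=> [x|d d0].
      exact: cvgM (kc x) (lc x).
    have [M M0 kM] := continuous_bounded Xc kc.
    have [N N0 lN] := continuous_bounded Xc lc.
    (* With this quotient as [q], a product errs by at most [M q + q N < d]. *)
    have q0 : 0 < d / (M + N + 1) by apply: divr_gt0 => //; lra.
    have [T1 T1S T1P] := kD _ q0; have [T2 T2S T2P] := lD _ q0.
    exists (T1 `|` T2)%fset => [s|x y /PU[/T1P p1 /T2P p2]] /=.
      by rewrite inE => /orP[/T1S|/T2S].
    have -> : k x * l x - k y * l y = k x * (l x - l y) + (k x - k y) * l y.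
      by ring.
    apply: (le_lt_trans (ler_normD _ _)); rewrite !normrM.
    have dE : d = d / (M + N + 1) * (M + N + 1) by field; lra.
    move: q0 p1 p2 dE; set q := d / _ => q0 p1 p2 ->.
    have h1 : `|k x| * `|l x - l y| <= M * q by apply: ler_pM => //; exact: ltW.
    have h2 : `|k x - k y| * `|l y| <= q * N by apply: ler_pM => //; exact: ltW.
    by rewrite !mulrDr mulr1; lra.
- move=> k kc kD; split=> // d d0.
  have d4 : 0 < d / 4 by lra.
  have [l [lc lD] kl] := kD _ d4; have [T TS TP] := lD _ d4.
  exists T => // x y /TP.
  have klc : continuous (k \- l) by move=> z; exact: cvgB (kc z) (lc z).
  have := le_lt_trans (le_sup_norm x Xc klc) kl.
  have := le_lt_trans (le_sup_norm y Xc klc) kl.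
  by rewrite /= !ltr_norml; lra.
Qed.

End prediction.

(** * Coding orbits *)

Section counting.
Context {R : realType}.

(** A Kraft-type inequality: the right side expands into the sum over all words of their weights,
    and each word of [E] contributes at least [q]. *)
Lemma weighted_count (I A : finType) (wt : A -> R) (E : {set {ffun I -> A}})
    (q : R) : (forall a, 0 <= wt a) ->
  (forall c, c \in E -> q <= \prod_i wt (c i)) ->
  #|E|%:R * q <= (\sum_a wt a) ^+ #|I|.
Proof.
move=> wt0 qE; rewrite -prodr_const bigA_distr_bigA/=.
rewrite -sum1_card natr_sum mulr_suml.
rewrite [leRHS](bigID [in E])/=; apply: ler_wpDr.
  by apply: sumr_ge0 => c _; apply: prodr_ge0.
by apply: ler_sum => c cE; rewrite mul1r; exact: qE.
Qed.

Lemma sum_geometric2 m M : \sum_(m <= j < M) 2 ^- j <= 2 * 2 ^- m :> R.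
Proof.
have [mM|/ltnW Mm] := leqP m M; last first.
  by rewrite big_geq// mulr_ge0// invr_ge0 exprn_ge0.
suff : \sum_(m <= j < M) 2 ^- j = 2 * 2 ^- m - 2 * 2 ^- M :> R.
  by move=> ->; rewrite gerBl mulr_ge0// invr_ge0 exprn_ge0.
elim: M mM => [|M IH].
  by rewrite leqn0 => /eqP ->; rewrite big_geq// subrr.
rewrite leq_eqVlt => /predU1P[->|]; first by rewrite big_geq// subrr.
rewrite ltnS => mM; rewrite big_nat_recr//= IH// exprS invfM.
by field; rewrite !expf_neq0.
Qed.

(** As [b] is downward closed, the sum counts the steps from [m] to the first failure of [b]. *)
Lemma first_false (b : nat -> bool) m M : (m <= M)%N ->
  (forall k k', (k <= k')%N -> b k' -> b k) ->
  ~~ b M -> ~~ b (m + \sum_(m <= j < M) b j)%N.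
Proof.
move=> mM bd; elim: M mM => [|M IH].
  by rewrite leqn0 => /eqP ->; rewrite big_geq.
rewrite leq_eqVlt => /predU1P[->|]; first by rewrite big_geq ?addn0.
rewrite ltnS => mM; rewrite big_nat_recr//=.
case bM : (b M); last by move=> _; rewrite addn0; apply: IH; rewrite ?bM.
rewrite (eq_big_nat _ _ (F2 := fun=> 1%N)).
  by rewrite sum_nat_const_nat muln1 addnA subnKC// addn1.
by move=> j /andP[_ /ltnW jM]; rewrite (bd _ _ jM).
Qed.

End counting.

Section semigroup.
Context {G : groupType} (S : set G).

(* Left multiplication by elements of S is well founded on a finite set, since
   it never comes back. *)
Lemma semigroup_ind (F : {fset G}) (P : G -> Prop) :
  subsemigroup S -> ~ S 1%g ->
  (forall g, g \in F ->
    (forall s, S s -> (s * g)%g \in F -> P (s * g)%g) -> P g) ->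
  forall g, g \in F -> P g.
Proof.
move=> SS S1 PS.
(* [up g] is the part of [S g] in [F]. It shrinks strictly from [g] to [s g]: [S s g] lies in [S g],
   and [s g] itself is lost since 1 is not in [S]. *)
pose up g : {fset G} := [fset k in F | `[< S (k * g^-1)%g >]]%fset.
suff : forall n g, (#|` up g| < n)%N -> g \in F -> P g.
  by move=> + g gF => /(_ _ g (ltnSn _) gF).
elim=> // n IH g gn gF; apply: PS => // s Ss sgF; apply: IH => //.
rewrite ltnS in gn; apply: leq_trans gn; apply: fproper_ltn_card.
rewrite fproperE; apply/andP; split; first (apply/fsubsetP => k).
  rewrite !inE/= => /andP[-> /asboolP kS]/=; apply/asboolP.
  by have := SS _ _ kS Ss; rewrite invgM !mulgA mulgVK.
apply/negP => /fsubsetP/(_ (s * g)%g).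
rewrite !inE/= sgF mulgK mulgV/= => /(_ (asboolT Ss))/asboolP.
exact: S1.
Qed.

End semigroup.

(** * Finite codes for orbit segments *)

Section codes.
Context {R : realType} {G : groupType} {X : topologicalType}.
Variable act : G -> X -> X.
Implicit Types (F : {fset G}) (rel : X -> X -> Prop) (Y : set X) (N : R).

Definition coded F rel Y N : Prop :=
  exists (A : finType) (E : {set A}) (c : X -> A),
    [/\ forall x, Y x -> c x \in E, #|E|%:R <= N
      & forall x y, Y x -> Y y -> c x = c y ->
          forall g, g \in F -> rel (act g x) (act g y)].

Lemma coded_le F rel Y Y' N N' : Y' `<=` Y -> N <= N' ->
  coded F rel Y N -> coded F rel Y' N'.
Proof.
move=> YY NN [A [E [c [cE EN cP]]]]; exists A, E, c; split.
- by move=> x /YY /cE.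
- exact: le_trans EN NN.
- by move=> x y /YY + /YY; exact: cP.
Qed.

Lemma coded_subrel F rel rel' Y N : (forall x y, rel x y -> rel' x y) ->
  coded F rel Y N -> coded F rel' Y N.
Proof.
move=> rr [A [E [c [cE EN cP]]]]; exists A, E, c; split=> // x y Yx Yy e g gF.
by apply: rr; exact: cP.
Qed.

Lemma codedU F rel Y Y' N N' :
  coded F rel Y N -> coded F rel Y' N' -> coded F rel (Y `|` Y') (N + N').
Proof.
move=> [A [E [c [cE EN cP]]]] [A' [E' [c' [cE' EN' cP']]]].
exists (A + A')%type, ([set inl a | a in E] :|: [set inr a | a in E'])%SET.
exists (fun x => if `[< Y x >] then inl (c x) else inr (c' x)); split.
- move=> x; rewrite inE; case: asboolP => [Yx _|nY [//|Y'x]].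
    by apply/orP; left; apply: imset_f; exact: cE.
  by apply/orP; right; apply: imset_f; exact: cE'.
- rewrite cardsU; apply: le_trans (_ : (#|E| + #|E'|)%:R <= _).
    rewrite ler_nat (leq_trans (leq_subr _ _))// leq_add// leq_imset_card//.
  by rewrite natrD lerD.
- move=> x y; case: asboolP => [Yx|nY] + +; case: asboolP => [Yy|nY'] + + //.
    by move=> _ _ [] /cP; exact.
  by move=> [//|Y'x] [//|Y'y] [] /cP'; exact.
Qed.

Lemma codedI F rel rel' Y N N' : coded F rel Y N -> coded F rel' Y N' ->
  coded F (fun x y => rel x y /\ rel' x y) Y (N * N').
Proof.
move=> [A [E [c [cE EN cP]]]] [A' [E' [c' [cE' EN' cP']]]].
exists (A * A')%type, (finset.setX E E'), (fun x => (c x, c' x)); split.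
- by move=> x Yx; rewrite inE /= cE ?cE'.
- by rewrite cardsX natrM ler_pM.
- by move=> x y Yx Yy [e e'] g gF; split; [exact: cP | exact: cP'].
Qed.

Lemma coded_true F Y : coded F (fun _ _ => True) Y 1.
Proof.
exists unit, [set: unit]%SET, (fun=> tt); split=> //.
by rewrite cardsT card_unit.
Qed.

End codes.

(** * The predictive encoding and its cost *)

Section coding.
Context {R : realType} {G : groupType} {X : topologicalType}.
Variables (act : G -> X -> X) (S : set G) (h : X -> R).
Implicit Types (F T : {fset G}) (w : nat -> nat) (k m M : nat) (x y : X).

Definition bad w k x g := level w k (h (act g x)) \isn't a Num.nat.

Definition nbad F w k x := (\sum_(g : F) bad w k x (val g))%N.

(** Stage 0 is exempt since [level w 0] involves no choice; thus [sparse F w 0] is all of [X]. *)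
Definition sparse F w M : set X :=
  [set x | forall k, (k < M)%N -> (nbad F w k.+1 x * 4 ^ k.+1 <= #|` F|)%N].

Definition boundary F T : nat :=
  (\sum_(s <- T) \sum_(g : F) ((s * val g)%g \notin F))%N.

Definition cheap w m M T F x g :=
  ~~ bad w m x g && all (fun s => (s * g \in F) && ~~ bad w M x (s * g))%g T.

(* The least k >= m at which [level w k] is an integer, capped at M. *)
Definition generation w m M x g := (m + \sum_(m <= j < M) bad w j x g)%N.

Definition symbol m M := option ('I_M.+1 * 'I_(2 ^ M).+2)%type.

(* [None] stands for a predicted value, [(2 ^ k).+1] for a non-integer level. *)
Definition encode w m M T F x g : symbol m M :=
  if cheap w m M T F x g then None else
    let k := generation w m M x g in
    Some (inord k, inord (if bad w M x g then (2 ^ k).+1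
                          else Num.truncn (level w k (h (act g x))))).

(** [4 ^- k] stands for the 2 k bits charged to a value recorded at generation [k]; pairs out of
    range get weight 0. *)
Definition weight m M (a : symbol m M) : R :=
  if a is Some (k, i) then
    if (m <= k)%N && (i <= (2 ^ k).+1)%N then 4 ^- k else 0
  else 1.

Hypothesis h01 : forall x, 0 <= h x <= 1.

Section encoding.
Variables (w : nat -> nat) (m M : nat) (T F : {fset G}).
Hypotheses (wa : admissible w) (mM : (m <= M)%N).

Lemma bad_anti k k' x g : (k <= k')%N -> bad w k' x g -> bad w k x g.
Proof.
have /andP[_ z1] := h01 (act g x).
by move=> kk; rewrite /bad; apply: contraNN => lk; exact: level_nat wa z1 kk lk.
Qed.

Lemma generation_le x g : (generation w m M x g <= M)%N.
Proof.
rewrite /generation -[leqRHS](subnKC mM) leq_add2l.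
rewrite -[leqRHS]muln1 -sum_nat_const_nat.
by apply: leq_sum => j _; case: bad.
Qed.

Lemma generation_good x g : ~~ bad w M x g ->
  ~~ bad w (generation w m M x g) x g.
Proof.
apply: (@first_false (fun k => bad w k x g)) => // k k'.
exact: bad_anti.
Qed.

Lemma truncn_level_le k x g : (Num.truncn (level w k (h (act g x))) <= 2 ^ k)%N.
Proof.
have /andP[z0 z1] := h01 (act g x).
rewrite -(ler_nat R) natrX; apply: (le_trans _ (level_le w k z1)).
by rewrite truncn_le level_ge0.
Qed.

Lemma weight_encode x g :
  weight (encode w m M T F x g) =
  4^-1 ^+ (~~ cheap w m M T F x g * generation w m M x g).
Proof.
rewrite /encode; case: cheap; first by rewrite mul0n expr0.
have kM := generation_le x g.
have iM : ((if bad w M x g then (2 ^ generation w m M x g).+1 else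
    Num.truncn (level w (generation w m M x g) (h (act g x)))) <=
    (2 ^ generation w m M x g).+1)%N.
  by case: bad => //; exact: leqW (truncn_level_le _ _ _).
rewrite mul1n /= inordK// leq_addr inordK; first by rewrite iM/= exprVn.
by rewrite ltnS (leq_trans iM)// ltnS leq_exp2l.
Qed.

Lemma weight_ge0 (a : symbol m M) : 0 <= weight a.
Proof.
by case: a => [[k i]|]//=; case: ifP => // _; rewrite invr_ge0 exprn_ge0.
Qed.

(** [None] weighs 1. Generation [k] has at most [3 * 2 ^ k] symbols of weight [4 ^- k], and the
    resulting series [3 * 2 ^- k] is geometric. *)
Lemma sum_weight : \sum_(a : symbol m M) weight a <= 1 + 6 * 2 ^- m :> R.
Proof.
rewrite (bigD1 (None : symbol m M))//= lerD2l.
rewrite (reindex_omap (Some : _ -> symbol m M) id)/=; last by case.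
rewrite (eq_bigl predT); last by move=> ?; rewrite eqxx.
rewrite (eq_bigr (fun p => weight (Some (p.1, p.2) : symbol m M)));
  last by case.
rewrite -(pair_bigA _ (fun a b => weight (Some (a, b) : symbol m M)))/=.
apply: (@le_trans _ _ (\sum_(m <= k < M.+1) 3 * 2 ^- k)); last first.
  rewrite -mulr_sumr (_ : 6 * _ = 3 * (2 * 2 ^- m)); last by ring.
  by rewrite ler_pM2l// sum_geometric2.
rewrite big_geq_mkord/= [leRHS]big_mkcond/=; apply: ler_sum => k _.
case: ifPn => mk /=; last by rewrite big1.
rewrite -big_mkcond/= sumr_const.
have c3 : (#|[pred i : 'I_(2 ^ M).+2 | (i <= (2 ^ k).+1)%N]| <= 3 * 2 ^ k)%N.
  have -> : #|[pred i : 'I_(2 ^ M).+2 | (i <= (2 ^ k).+1)%N]| = (2 ^ k).+2.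
    rewrite -sum1_card.
    rewrite (eq_bigl (fun i : 'I_(2 ^ M).+2 => (i < (2 ^ k).+2)%N))//.
    rewrite -(big_ord_widen _ (fun=> 1%N)) ?sum1_card ?card_ord//.
    by rewrite !ltnS leq_exp2l// -ltnS.
  have : (0 < 2 ^ k)%N by rewrite expn_gt0. lia.
rewrite -[leLHS]mulr_natl; apply: (@le_trans _ _ ((3 * 2 ^ k)%:R * 4 ^- k)).
  by apply: ler_wpM2r; [rewrite invr_ge0 exprn_ge0 | rewrite ler_nat].
have -> : 4 = 2 * 2 :> R by ring.
rewrite natrM natrX exprMn invfM -!mulrA ler_pM2l// mulrA divff ?mul1r//.
Qed.

Hypotheses (SS : subsemigroup S) (S1 : ~ S 1%g) (TS : forall s, s \in T -> S s).
Hypothesis actM : forall g g' x, act (g * g')%g x = act g (act g' x).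
Hypothesis predT : forall x y,
  (forall s, s \in T -> cantor w (h (act s x)) = cantor w (h (act s y))) ->
  `|cantor w (h x) - cantor w (h y)| < 2 ^- m.

Lemma good_cantorE k x g : ~~ bad w k x g ->
  cantor w (h (act g x)) = level w k (h (act g x)) / 2 ^+ k.
Proof. by move/negPn => lk; exact: cantorE. Qed.

(** By [semigroup_ind] the points [s g] in [F] are already settled. A recorded symbol gives the
    generation and the level, hence the value; a predicted one refers back to the values at the
    [s g]. *)
Lemma encode_inj x y :
  (forall g, g \in F -> encode w m M T F x g = encode w m M T F y g) ->
  forall g, g \in F -> bad w M x g = bad w M y g /\
    (~~ bad w M x g -> cantor w (h (act g x)) = cantor w (h (act g y))).
Proof.
move=> xy; apply: (semigroup_ind SS S1) => g gF IH.
have := xy g gF; rewrite /encode.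
have good_cheap z : cheap w m M T F z g -> ~~ bad w M z g.
  by case/andP=> + _; apply: contraNN; exact: bad_anti.
case xc : (cheap w m M T F x g); case yc : (cheap w m M T F y g) => //.
  move=> _; have := good_cheap _ xc; have := good_cheap _ yc.
  move=> /negPf yM /negPf xM; rewrite xM yM; split=> // _.
  have /andP[xm /allP xT] := xc; have /andP[ym /allP yT] := yc.
  have : `|cantor w (h (act g x)) - cantor w (h (act g y))| < 2 ^- m.
    apply: predT => s sT; rewrite -!actM.
    have /andP[sgF xs] := xT s sT.
    by have [_] := IH s (TS sT) sgF; apply.
  (* Both values are integer multiples of [2 ^- m] at distance less than [2 ^- m], hence equal. *)
  rewrite !(good_cantorE xm) !(good_cantorE ym).
  move: xm ym => /negPn/natrP[a ->] /negPn/natrP[b ->].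
  rewrite -mulrBl normrM (gtr0_norm (x := _^-1)) ?invr_gt0 ?exprn_gt0//.
  rewrite -ltr_pdivlMr ?invr_gt0 ?exprn_gt0// mulfV ?invr_neq0 ?expf_neq0//.
  rewrite [a%:R]pmulrn [b%:R]pmulrn -intrB -intr_norm ltrz1.
  by move=> ab; have -> : a = b by lia.
case=> /(congr1 val) e /(congr1 val).
have kxM := generation_le x g; have kyM := generation_le y g.
rewrite /= !inordK ?ltnS// in e; rewrite -e /=.
set k := generation w m M x g in kxM e *.
have p2 : (2 ^ k <= 2 ^ M)%N by rewrite leq_exp2l.
have tM z : (Num.truncn (level w k (h (act g z))) < (2 ^ M).+2)%N.
  by rewrite !ltnS ltnW// ltnS (leq_trans (truncn_level_le _ _ _)).
have := truncn_level_le k x g; have := truncn_level_le k y g.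
case xM : (bad w M x g); case yM : (bad w M y g) => //=;
  rewrite !inordK ?tM ?ltnS//.
(* If only one of the points is bad, its mark [(2 ^ k).+1] exceeds the truncated level of the
   other. *)
- by move=> + _ E; rewrite -E ltnn.
- by move=> _ + E; rewrite E ltnn.
move=> _ _ E; split=> // _.
have gx : ~~ bad w k x g by apply: generation_good; rewrite xM.
have gy : ~~ bad w k y g by rewrite e; apply: generation_good; rewrite yM.
rewrite (good_cantorE gx) (good_cantorE gy).
by rewrite -(truncnK (negPn gx)) E (truncnK (negPn gy)).
Qed.

Lemma sum_bad_shift (s : G) x :
  (\sum_(g : F) ((s * val g)%g \in F) && bad w M x (s * val g)%g <=
   nbad F w M x)%N.
Proof.
apply: (@leq_trans
    (\sum_(g : F) \sum_(g' : F | val g' == (s * val g)%g) bad w M x (val g'))).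
  apply: leq_sum => g _; case: (boolP (_ \in F)) => //= sgF.
  by rewrite (bigD1 [` sgF]%fset)//= leq_addr.
rewrite (exchange_big_dep xpredT)//=; apply: leq_sum => g' _.
rewrite sum_nat_const -[leqRHS]mul1n leq_mul2r; apply/orP; right.
apply/card_le1_eqP => g1 g2 /eqP e1 /eqP e2.
by apply: val_inj; apply: (@mulgI _ s); rewrite -e1 -e2.
Qed.

(** A recorded [g] is bad at [m], or some [s g] is outside [F] or bad at [M]; each such cause is
    charged [m]. The excess of the generation over [m] counts bad levels below [M]. *)
Lemma cost_le x :
  (\sum_(g : F) ~~ cheap w m M T F x (val g) * generation w m M x (val g) <=
   m * (nbad F w m x + boundary F T + #|` T| * nbad F w M x) +
   \sum_(m <= j < M) nbad F w j x)%N.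
Proof.
have c g : (~~ cheap w m M T F x g <= bad w m x g +
    \sum_(s <- T) (((s * g)%g \notin F) +
      (((s * g)%g \in F) && bad w M x (s * g)%g)))%N.
  rewrite /cheap negb_and negbK; case: bad => //=.
  case: (boolP (all _ _)) => //= /allPn[s sT].
  rewrite negb_and negbK => sg; rewrite add0n (big_rem s)//=.
  by apply: leq_trans (leq_addr _ _); case: (_ \in F) sg => //= ->.
apply: (@leq_trans (\sum_(g : F) (m * (bad w m x (val g) +
    \sum_(s <- T) (((s * val g)%g \notin F) +
      (((s * val g)%g \in F) && bad w M x (s * val g)%g)))
    + \sum_(m <= j < M) bad w j x (val g)))).
  apply: leq_sum => g _; rewrite /generation mulnDr leq_add//.
    by rewrite mulnC leq_mul2l c orbT.
  by case: cheap; rewrite ?mul0n ?mul1n.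
rewrite big_split/= exchange_big/= leq_add2r// -big_distrr/= leq_mul2l.
apply/orP; right; rewrite big_split/= -addnA leq_add2l exchange_big/= /boundary.
rewrite (eq_bigr _ (fun s _ => big_split _ _ _ _ _))/= big_split/= leq_add2l.
rewrite cardfE -sum1_card -(big_seq_fsetE _ _ xpredT (fun=> 1%N)) big_distrl/=.
by apply: leq_sum => s _; rewrite mul1n sum_bad_shift.
Qed.

End encoding.


Definition compatible x y : Prop := ~ (h x = 0 /\ h y = 1).

Lemma nbad_le_card F w k x : (nbad F w k x <= #|` F|)%N.
Proof.
by rewrite cardfE -sum1_card; apply: leq_sum => g _; case: bad.
Qed.

(** Each of the three terms with factor [m] is at most [2 ^- m] times the size of [F], and the last
    sum at most twice that, by a geometric series. *)
Lemma cost_sparse F T w m M x : (m <= M)%N -> (m * #|` T| * 2 ^ m <= 4 ^ M)%N ->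
  (m * 2 ^ m * boundary F T <= #|` F|)%N -> sparse F w M x ->
  (m * (nbad F w m x + boundary F T + #|` T| * nbad F w M x) +
     \sum_(m <= j < M) nbad F w j x)%:R <= 5 * 2 ^- m * #|` F|%:R :> R.
Proof.
move=> mM TM bF sp; set n := #|` F|.
have nb k : (k <= M)%N -> (nbad F w k x * 4 ^ k <= n)%N.
  case: k => [|k] kM; first by rewrite muln1 nbad_le_card.
  exact: sp.
have m2 : (m <= 2 ^ m)%N by rewrite ltnW// ltn_expl.
have to_real a : (a * 2 ^ m <= n)%N -> a%:R <= 2 ^- m * n%:R :> R.
  rewrite -(ler_nat R) natrM natrX => an.
  by rewrite mulrC ler_pdivlMr ?exprn_gt0.
have h1 : (m * nbad F w m x)%:R <= 2 ^- m * n%:R :> R.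
  apply: to_real; apply: leq_trans (nb m mM).
  rewrite (_ : 4 = 2 * 2)%N// expnMn mulnA leq_mul2r; apply/orP; right.
  by rewrite mulnC leq_mul2l m2 orbT.
have h2 : (m * boundary F T)%:R <= 2 ^- m * n%:R :> R.
  by apply: to_real; rewrite mulnAC.
have h3 : (m * (#|` T| * nbad F w M x))%:R <= 2 ^- m * n%:R :> R.
  apply: to_real; apply: leq_trans (nb M (leqnn M)).
  by rewrite mulnA mulnAC [leqRHS]mulnC leq_mul2r TM orbT.
have h4 : (\sum_(m <= j < M) nbad F w j x)%:R <= 2 * 2 ^- m * n%:R :> R.
  rewrite natr_sum.
  apply: (@le_trans _ _ ((\sum_(m <= j < M) 2 ^- j) * n%:R)); last first.
    by rewrite ler_wpM2r// sum_geometric2.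
  rewrite mulr_suml big_nat_cond [leRHS]big_nat_cond.
  apply: ler_sum => j /andP[/andP[_ /ltnW jM] _].
  rewrite mulrC ler_pdivlMr ?exprn_gt0// -natrX -natrM ler_nat.
  apply: leq_trans (nb j jM); rewrite leq_mul2l (_ : 4 = 2 * 2)%N// expnMn.
  by rewrite leq_pmulr ?orbT// expn_gt0.
rewrite natrD !mulnDr !natrD; lra.
Qed.

(** With [n] the size of [F], the code of a sparse point weighs at least [exp (- 10 * 2 ^- m * n)],
    while the total weight is at most [exp (6 * 2 ^- m * n)]; hence the constant 16. *)
Lemma coded_sparse F T w m M :
  subsemigroup S -> ~ S 1%g -> (forall s, s \in T -> S s) ->
  (forall g g' x, act (g * g')%g x = act g (act g' x)) ->
  admissible w -> (m <= M)%N ->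
  (forall x y,
    (forall s, s \in T -> cantor w (h (act s x)) = cantor w (h (act s y))) ->
    `|cantor w (h x) - cantor w (h y)| < 2 ^- m) ->
  (m * #|` T| * 2 ^ m <= 4 ^ M)%N -> (m * 2 ^ m * boundary F T <= #|` F|)%N ->
  coded act F compatible (sparse F w M) (expR (16 * 2 ^- m * #|` F|%:R) : R).
Proof.
move=> SS S1 TS actM wa mM predT TM bF.
pose code x := [ffun g : F => encode w m M T F x (val g)].
exists {ffun F -> symbol m M}.
exists [set c | `[< exists2 x, sparse F w M x & c = code x >]]%SET, code; split.
- by move=> x spx; rewrite inE; apply/asboolP; exists x.
- have four : expR (- 2) <= 4^-1 :> R.
    rewrite expRN lef_pV2 ?posrE ?expR_gt0//.
    have -> : 2 = 1 + 1 :> R by [].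
    by have e1 := expR_ge1Dx (1 : R); rewrite expRD; nra.
  set n := #|` F|%:R; set q := expR (- (10 * 2 ^- m * n)).
  have q0 : 0 < q by exact: expR_gt0.
  rewrite -(ler_pM2r q0) -expRD.
  apply: le_trans (@weighted_count R _ _ (@weight m M) _ q _ _) _.
  + exact: weight_ge0.
  + move=> c; rewrite inE => /asboolP[x spx ->].
    under eq_bigr do rewrite ffunE weight_encode//.
    rewrite prodrXr.
    apply: (@le_trans _ _ (expR (-2) ^+ (\sum_(g : F)
        ~~ cheap w m M T F x (val g) * generation w m M x (val g))%N)).
      rewrite -expRM_natr ler_expR mulNr lerN2.
      rewrite (_ : 10 * _ * n = 2 * (5 * 2 ^- m * n)); last by ring.
      rewrite ler_pM2l//; apply: le_trans (cost_sparse mM TM bF spx).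
      by rewrite ler_nat cost_le.
    by apply: lerXn2r => //; rewrite nnegrE ?expR_ge0.
  + rewrite -cardfE.
    apply: (@le_trans _ _ (expR (6 * 2 ^- m) ^+ #|` F|)).
      apply: lerXn2r; rewrite ?nnegrE ?expR_ge0//.
        by apply: sumr_ge0 => a _; exact: weight_ge0.
      by apply: (le_trans (sum_weight mM)); exact: expR_ge1Dx.
    rewrite -expRM_natr ler_expR -/n; lra.
- move=> x y _ _ /ffunP e g gF [hx hy].
  have e' g' : g' \in F -> encode w m M T F x g' = encode w m M T F y g'.
    by move=> g'F; have := e [` g'F]%fset; rewrite !ffunE.
  have [exy gxy] := encode_inj wa mM SS S1 TS actM predT e' gF.
  (* The value 0 is an integer at stage 0, hence at stage [M]; equal codes would then give
     [cantor w 0 = cantor w 1]. *)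
  have gx : ~~ bad w M x g.
    rewrite negbK; apply: (level_nat (k := 0) wa); rewrite ?hx//= ?rpred0//.
  have := gxy gx; rewrite hx hy cantor0// cantor1//.
  by move/eqP; rewrite eq_sym oner_eq0.
Qed.

Lemma nbad_ext F w w' k x : (forall i, (i < k)%N -> w i = w' i) ->
  nbad F w k x = nbad F w' k x.
Proof. by move=> e; apply: eq_bigr => g _; rewrite /bad (eq_level _ e). Qed.

Lemma sparse_ext F w w' M x : (forall i, (i < M)%N -> w i = w' i) ->
  sparse F w M x -> sparse F w' M x.
Proof.
move=> e sp k kM; rewrite (@nbad_ext F w' w); first exact: sp.
by move=> i ik; rewrite e// (leq_trans ik kM).
Qed.

(** Pigeonhole: the bad sets of the [4 ^ k.+1] choices at stage [k] are disjoint, so their counts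
    add up to at most the size of [F]. *)
Lemma sparse_split F w k x : sparse F w k x ->
  exists2 j, (j < 4 ^ k.+1)%N & sparse F [eta w with k |-> j] k.+1 x.
Proof.
move=> sp; pose L := (4 ^ k.+1)%N; pose v j := [eta w with k |-> j].
have ve j i : (i < k)%N -> v j i = w i.
  by move=> ik; rewrite /v /= ltn_eqF.
have sum_le : (\sum_(j < L) nbad F (v j) k.+1 x <= #|` F|)%N.
  rewrite exchange_big/= cardfE -sum1_card; apply: leq_sum => g _.
  rewrite -big_mkcond/= -/(bad _ _ _ _) sum1_card.
  apply/card_le1_eqP => j j' jb j'b; apply: val_inj => /=.
  have vk (i : 'I_L) : v i k = i by rewrite /v /= eqxx.
  rewrite -[val j]vk -[val j']vk.
  apply: (level_inj (z := h (act (val g) x))) => //.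
  - by move=> i ik; rewrite !ve.
  - by rewrite vk ltn_ord.
  - by rewrite vk ltn_ord.
have [j jP] : exists j : 'I_L, (nbad F (v j) k.+1 x * L <= #|` F|)%N.
  apply/existsP; apply: contraT; rewrite negb_exists => /forallP nj.
  suff : (L * #|` F| < L * #|` F|)%N by rewrite ltnn.
  apply: (@leq_trans (L * #|` F|.+1)); first by rewrite ltn_pmul2l ?expn_gt0.
  apply: (@leq_trans (\sum_(j < L) nbad F (v j) k.+1 x * L)); last first.
    by rewrite -big_distrl/= mulnC leq_mul2l sum_le orbT.
  rewrite -[X in (X * _ <= _)%N]card_ord -sum_nat_const; apply: leq_sum => j _.
  by rewrite ltnNge.
exists j => // i; rewrite ltnS leq_eqVlt => /predU1P[->//|ik].
rewrite (@nbad_ext F (v j) w); first exact: sp.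
by move=> a ai; apply: ve; exact: leq_trans ai ik.
Qed.

End coding.

(** * Følner sequences *)

Section folner.
Context {R : realType} {G : groupType}.
Variables (S : set G) (F : nat -> {fset G}).
Hypothesis FF : folner (R := R) F.

Lemma boundary1_le (E : {fset G}) (s : G) :
  (\sum_(g : E) ((s * val g)%g \notin E) <=
   #|` ([fset (s * x)%g | x in E] `\` E)%fset|)%N.
Proof.
rewrite -(big_seq_fsetE _ _ xpredT (fun g => ((s * g)%g \notin E : nat)))/=.
rewrite -big_mkcond/= sum1_count -size_filter -(size_map (fun g => (s * g)%g)).
apply: uniq_leq_size.
  by rewrite map_inj_uniq ?filter_uniq ?fset_uniq// => a b; exact: mulgI.
move=> _ /mapP[g + ->]; rewrite mem_filter => /andP[sgE gE].
by rewrite !inE sgE /=; apply/imfsetP; exists g.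
Qed.

Lemma folner_boundary (T : {fset G}) (K : nat) :
  \forall n \near \oo, (K * boundary (F n) T <= #|` F n|)%N.
Proof.
have near_s s : \forall n \near \oo,
    (K * #|` T|.+1 * \sum_(g : F n) ((s * val g)%g \notin F n) <= #|` F n|)%N.
  have [F0 Fcvg] := FF.
  (* A tolerance small enough to be summed over [T]; the successors avoid a division by 0. *)
  have e0 : 0 < (K.+1 * #|` T|.+1)%:R^-1 :> R by rewrite invr_gt0 ltr0n.
  have /cvgrPdist_lt/(_ _ e0) := Fcvg s.
  apply: filterS => n /=; rewrite sub0r normrN ger0_norm ?divr_ge0//.
  rewrite ltr_pdivrMr ?ltr0n ?cardfs_gt0//.
  rewrite mulrC ltr_pdivlMr ?ltr0n// -natrM ltr_nat => /ltnW h.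
  apply: leq_trans h; rewrite mulnC leq_mul ?boundary1_le//.
  by rewrite leq_mul2r leqnSn orbT.
have : \forall n \near \oo, forall s : T,
    (K * #|` T|.+1 * \sum_(g : F n) ((val s * val g)%g \notin F n) <=
     #|` F n|)%N.
  by apply: filter_forall => s; exact: near_s.
apply: filterS => n hn; rewrite /boundary big_seq_fsetE/= big_distrr/=.
have [T0|Tn0] := eqVneq #|` T| 0%N.
  rewrite big1// => s _; exfalso; suff : (0 < #|` T|)%N by rewrite T0.
  by rewrite cardfs_gt0; apply/fset0Pn; exists (val s); exact: fsvalP.
rewrite -(@leq_pmul2l #|` T|) ?lt0n// big_distrr/=.
apply: (@leq_trans (\sum_(s : T) #|` F n|)); last first.
  by rewrite sum_nat_const leq_mul2r (cardfE T) leqnn orbT.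
apply: leq_sum => s _; apply: leq_trans (hn s).
by rewrite mulnCA mulnA leq_mul2r leq_mul2l leqnSn !orbT.
Qed.

(** Multiplication by [s] must leave [F n] somewhere, by [semigroup_ind]. So the boundary for [s] is
    at least 1, while [K] times it is eventually at most the size of [F n]. *)
Lemma folner_card (K : nat) : subsemigroup S -> ~ S 1%g -> S !=set0 ->
  \forall n \near \oo, (K <= #|` F n|)%N.
Proof.
move=> SS S1 [s Ss]; have [F0 _] := FF.
have := folner_boundary [fset s]%fset K; apply: filterS => n.
apply: leq_trans; rewrite leq_pmulr// lt0n /boundary big_seq_fset1.
apply/negP; rewrite sum_nat_eq0 => /forallP s0.
have /fset0Pn[g gF] := F0 n.
apply: (semigroup_ind (P := fun=> False) SS S1 _ gF) => {}g {}gF.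
move=> /(_ s Ss); apply.
by have := s0 [` gF]%fset; rewrite /= eqb0 negbK.
Qed.

End folner.

(** * The tree of choices *)

Section tree.
Context {R : realType} {G : groupType} {X : topologicalType}.
Variables (act : G -> X -> X) (S : set G) (h : X -> R) (F : nat -> {fset G}).
Hypotheses (Xc : compact [set: X]) (actc : forall g, continuous (act g))
  (actM : forall g g' x, act (g * g')%g x = act g (act g' x))
  (SS : subsemigroup S) (S1 : ~ S 1%g) (FF : folner (R := R) F).
Hypothesis generated : forall f : X -> R, continuous f ->
  closed_algebra_generated
    ([set f \o act s | s in S] `|` [set cst c | c in [set: R]]) f.
Hypotheses (hc : continuous h) (h01 : forall x, 0 <= h x <= 1).

(** The factor [C], independent of [n], absorbs the number of branches in a finite union. *)
Definition tame m (Y : nat -> set X) : Prop := exists C : R,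
  \forall n \near \oo, coded act (F n) (compatible h) (Y n)
    (C * expR (16 * 2 ^- m * #|` F n|%:R)).

Lemma tame_bigU m (Y : nat -> nat -> set X) J :
  (forall j, (j < J)%N -> tame m (Y j)) ->
  tame m (fun n => [set x | exists2 j, (j < J)%N & Y j n x]).
Proof.
elim: J => [_|J IH YJ].
  exists 0; near=> n; exists unit, finset.set0, (fun=> tt).
  by split=> [x []//||x y []//]; rewrite cards0 mul0r.
have [|C CP] := IH; first by move=> j jJ; apply: YJ; exact: ltnW.
have [C' CP'] := YJ J (ltnSn J).
exists (C + C'); apply: filterS2 CP CP' => n c c'.
rewrite mulrDl; apply: coded_le (codedU c c') => // x [j].
rewrite ltnS leq_eqVlt => /predU1P[->|jJ] Yx; first by right.
by left; exists j.
Unshelve. all: by end_near. Qed.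

Lemma tame_branch m w : admissible w ->
  exists M, tame m (fun n => sparse act h (F n) w M).
Proof.
move=> wa.
have fc : continuous (cantor w \o h) by exact: continuous_cantor.
have e0 : 0 < 2 ^- m :> R by rewrite invr_gt0 exprn_gt0.
have [T TS predT] := finite_prediction Xc actc fc (generated fc) e0.
(* Since [a <= 2 ^ a] for [m] and for the size of [T], this [M] makes [4 ^ M] large enough for
   [coded_sparse]. *)
exists (m + #|` T|)%N, 1.
have := folner_boundary FF T (m * 2 ^ m); apply: filterS => n bn.
rewrite mul1r; apply: (coded_sparse h01 SS S1 TS) => //; first exact: leq_addr.
rewrite (_ : 4 = 2 * 2)%N// expnMn expnD leq_mul//; last first.
  by rewrite leq_pmulr// expn_gt0.
by rewrite leq_mul// ltnW// ltn_expl.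
Qed.

(* König's lemma: if the whole tree of choices were not tame, it would have a
   branch all of whose initial segments are not tame. *)
Lemma tame_setT m : tame m (fun=> setT).
Proof.
apply: contrapT => ntame.
pose good w k := tame m (fun n => sparse act h (F n) w k).
pose next_to (w : nat -> nat) k j :=
  ~ good w k -> (j < 4 ^ k.+1)%N /\ ~ good [eta w with k |-> j] k.+1.
have nextE (p : (nat -> nat) * nat) : exists j, next_to p.1 p.2 j.
  case: p => w k; have [gw|ngw] := pselect (good w k).
    by exists 0%N => /(_ gw).
  (* A node all of whose children are good is good, as the children cover it by [sparse_split]. *)
  apply: contrapT => nj; apply: ngw.
  have gj j : (j < 4 ^ k.+1)%N -> good [eta w with k |-> j] k.+1.
    by move=> jL; apply: contrapT => ngj; apply: nj; exists j => _; split.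
  have [C CP] := tame_bigU gj; exists C; apply: filterS CP => n.
  apply: coded_le => // x; exact: sparse_split.
have [nxt nxtP] := choice nextE.
(* [W k] holds the first [k] choices, with 0 afterwards; [w] is the infinite branch they define. *)
pose W := fix W k := if k is k'.+1
  then [eta W k' with k' |-> nxt (W k', k')] else fun=> 0%N.
pose w k := W k.+1 k.
have Ww k i : (i < k)%N -> W k i = w i.
  elim: k => // k IH; rewrite ltnS leq_eqVlt => /predU1P[->//|ik].
  by rewrite /= ltn_eqF// IH.
have bad k : ~ good (W k) k.
  elim: k => [[C CP]|k IH]; last by have [] := nxtP (W k, k) IH.
  apply: ntame; exists C; apply: filterS CP => n c.
  by apply: coded_le c => // x _ ?.
have wa : admissible w.
  by move=> k; rewrite /w /= eqxx; have [] := nxtP (W k, k) (bad k).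
(* [sparse] at depth [M] reads only the first [M] choices, on which [w] and [W M] agree. *)
have [M [C CP]] := tame_branch m wa; apply: (bad M); exists C.
apply: filterS CP => n; apply: coded_le => // x; apply: sparse_ext.
exact: Ww.
Qed.

Lemma coded_eventually (e : R) : 0 < e ->
  \forall n \near \oo,
    coded act (F n) (compatible h) setT (expR (e * #|` F n|%:R)).
Proof.
(* If [S] is empty, [F n] need not grow; but then [T] is empty too, [h] varies by less than 1, and
   one code suffices. *)
move=> e0; have [S0|/set0P[s Ss]] := eqVneq S set0.
  have [T TS hT] := finite_prediction Xc actc hc (generated hc) (@ltr01 R).
  have hconst x y : `|h x - h y| < 1.
    by apply: hT => s /TS; rewrite S0.
  near=> n; exists unit, [set: unit]%SET, (fun=> tt); split=> //.
    by rewrite cardsT card_unit -expR0 ler_expR mulr_ge0// ltW.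
  move=> x y _ _ _ g _ [hx hy]; have := hconst (act g x) (act g y).
  by rewrite hx hy sub0r normrN normr1 ltxx.
(* Now [16 * 2 ^- m < e / 2]; the other half of [e] pays for [C] once [F n] has at least [K]
   elements. *)
have [m me] : exists m, 2 ^- m < e / 32 :> R by apply: invexp2_lt; lra.
have [C CP] := tame_setT m.
pose K := (Num.truncn (2 * C / e)).+1.
have := folner_card FF K SS S1 (ex_intro _ s Ss).
apply: filterS2 CP => n c Kn; apply: coded_le c => //; move: Kn.
set q := #|` F n|%:R; rewrite -(ler_nat R) -/q => Kq.
have eq2 : C <= e * q / 2.
  have := truncnS_gt (2 * C / e); rewrite ltr_pdivrMr// -/K => CK.
  have : K%:R * e <= q * e by rewrite ler_pM2r.
  lra.
apply: (@le_trans _ _ (expR (e * q / 2) * expR (e * q / 2))); last first.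
  by rewrite -expRD -splitr.
have Ce : C <= expR (e * q / 2).
  by apply: (le_trans eq2); apply: le_trans (expR_ge1Dx _); rewrite lerDr.
apply: (le_trans (ler_wpM2r (expR_ge0 _) Ce)); rewrite ler_pM2l ?expR_gt0//.
rewrite ler_expR (_ : e * q / 2 = e / 2 * q); last by ring.
by apply: ler_wpM2r; rewrite ?ler0n//; lra.
Unshelve. all: by end_near. Qed.

End tree.

(** * From codes to entropy *)

Section entropy_bounds.
Context {R : realType} {G : groupType} {X : topologicalType}.
Variable act : G -> X -> X.
Implicit Types (U : set (set X)) (E : {fset G}).

(** For each code in use fix a point [x] with this code and, for each [g], a member of [U]
    containing all that is related to [g x]. The intersection of the preimages is a member of the
    join containing every point with this code. *)
Lemma cover_number_le_coded E rel U (N : R) :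
  (forall x, exists2 V, U V & forall y, rel x y -> V y) ->
  coded act E rel setT N -> cover_number (R := R) (cover_join act E U) <= N.
Proof.
move=> relU [A [C [c [cC CN cP]]]]; apply: le_trans CN.
have member a : exists W : set X, (exists x, c x = a) ->
    cover_join act E U W /\ forall x, c x = a -> W x.
  have [[x xa]|] := pselect (exists x, c x = a); last by exists set0.
  have [V VP] : exists V : G -> set X, forall g,
      U (V g) /\ forall y, rel (act g x) y -> V g y.
    have /choice[V VP] : forall g, exists V,
        U V /\ forall y, rel (act g x) y -> V y.
      by move=> g; have [V UV relV] := relU (act g x); exists V.
    by exists V.
  exists (\bigcap_(g in [set` E]) (act g @^-1` V g)) => _; split.
    by exists V => // g _; case: (VP g).
  move=> y ya g gE; case: (VP g) => _; apply; apply: cP => //.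
  by rewrite xa ya.
have [W WP] := choice member.
pose B := [fset W a | a in [seq a <- enum C | `[< exists x, c x = a >]]]%fset.
apply: (@le_trans _ _ #|` B|%:R).
  have lb : has_lbound ([set #|` B'|%:R | B' in [set B' : {fset (set X)} |
      [set` B'] `<=` cover_join act E U /\
      cover [set` B'] id = [set: X]]] : set R).
    by exists 0 => _ [? _ <-].
  apply: (ge_inf lb); exists B => //; split.
    move=> _ /imfsetP[a + ->]; rewrite /= mem_filter => /andP[/asboolP ax _].
    by case: (WP a ax).
  apply/seteqP; split=> // x _; exists (W (c x)) => /=.
    apply/imfsetP; exists (c x) => //=; rewrite mem_filter mem_enum cC// andbT.
    by apply/asboolP; exists x.
  by have [_] := WP _ (ex_intro _ x erefl); apply.
rewrite ler_nat; apply: leq_trans (leq_imfset_card _ _ _) _.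
rewrite cardE; apply: uniq_leq_size; first exact: enum_finmem_uniq.
by move=> a; rewrite enum_finmemE /= mem_filter => /andP[].
Qed.

Lemma ln_cover_number_ge0 U : 0 <= ln (cover_number U : R).
Proof.
rewrite /cover_number; set A := (X in inf X).
(* The infimum of the empty set and the logarithm of 0 are 0 by default; 0 belongs to [A] only if
   [X] is empty. *)
have [->|/set0P An0] := eqVneq A set0; first by rewrite inf0 ln0.
have [[B BP B0]|nB] := pselect (A 0).
  rewrite ln0//; apply: ge_inf; last by exists B.
  by exists 0 => _ [B' _ <-].
apply: ln_ge0; apply: lb_le_inf => // _ [B BP <-].
rewrite (ler_nat _ 1) lt0n; apply/eqP => B0; apply: nB; exists B => //.
by rewrite B0.
Qed.

Lemma limn_esup_le0 (u : nat -> R) :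
  (forall e, 0 < e -> \forall n \near \oo, u n <= e) ->
  (limn_esup (fun n => (u n)%:E) <= 0)%E.
Proof.
move=> ue; apply/lee_addgt0Pr => e e0; rewrite add0e /limn_esup limf_esupE.
apply: ge_ereal_inf; eexists; first by exists [set n | u n <= e]; [exact: ue|].
by apply: ge_ereal_sup => _ [n + <-]; rewrite lee_fin.
Qed.

End entropy_bounds.

(** * Functions subordinate to an open cover *)

Section metric.
Context {R : realType} {X : metricType R}.

Lemma continuous_mdist (p : X) : continuous (mdist p : X -> R).
Proof.
move=> x; apply/cvgrPdist_lt => e e0.
have := nbhsx_ballx x e e0; rewrite ballEmdist; apply: filterS => y /= xy.
have := metric_triangle p x y; have := metric_triangle p y x.
rewrite (metric_sym y x) ltr_norml; lra.
Qed.

(** For [r p > 0] it vanishes within distance [r p] of [p] and is 1 from distance [2 * r p] on. *)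
Definition bump (r : X -> R) p x : R := clip (mdist p x / r p - 1).

Lemma continuous_bump r p : continuous (bump r p).
Proof.
apply: continuous_clip => x; apply: cvgB; last exact: cvg_cst.
by apply: cvgMl; exact: continuous_mdist.
Qed.

(** Finitely many balls of radius [r p] cover [X]. If [x] is in the ball about [p], its bump is 0,
    so that of [y] is not 1 and [y] is in the ball of radius [2 * r p], contained in a member of
    [U]. *)
Lemma finite_bumps (U : set (set X)) : compact [set: X] -> open_cover U ->
  exists (r : X -> R) (D : {fset X}), forall x, exists2 V, U V &
    forall y, (forall p, p \in D -> compatible (bump r p) x y) -> V y.
Proof.
move=> Xc [Uo Ucov].
have Ux x : exists rV : R * set X,
    [/\ 0 < rV.1, U rV.2 & forall y, mdist x y < 2 * rV.1 -> rV.2 y].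
  have [V UV Vx] : cover U id x by rewrite Ucov.
  have /nbhs_ballP[e e0 eV] : nbhs x V.
    by apply: open_nbhs_nbhs; split=> //; exact: Uo.
  exists (e / 2, V); split=> //=; first by rewrite divr_gt0.
  move=> y xy; apply: eV; rewrite ballEmdist/=.
  by move: xy; rewrite mulrC divfK.
have [rV rVP] := choice Ux; exists (fun x => (rV x).1).
(* The filter of large finite sets of centres turns near-covering compactness into a finite
   subcover. *)
pose big : set_system {fset X} :=
  [set A | exists D0 : {fset X}, forall D, (D0 `<=` D)%fset -> A D].
have bigF : Filter big.
  split; first by exists fset0.
    move=> A B [D0 AD] [D1 BD]; exists (D0 `|` D1)%fset => D; rewrite fsubUset.
    by move=> /andP[/AD ? /BD].
  by move=> A B AB [D0 AD]; exists D0 => D /AD /AB.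
have /compact_near_coveringP/(_ _ big
    (fun (D : {fset X}) x => exists2 p, p \in D & mdist p x < (rV p).1) bigF)
  := Xc.
case.
  move=> x _; have [r0 _ _] := rVP x.
  exists (ball x (rV x).1, [set D : {fset X} | x \in D]).
    split=> /=; first exact: nbhsx_ballx.
    by exists [fset x]%fset => D; rewrite fsub1set.
  by move=> [y D] [/=]; rewrite ballEmdist => xy xD; exists x.
move=> D /(_ D (fsubset_refl _)) DP; exists D => x.
have [p pD px] := DP x I; have [r0 UV V2] := rVP p.
exists (rV p).2 => // y /(_ p pD) xy; apply: V2.
rewrite ltNge; apply/negP => py; apply: xy; split.
  by apply: clip_eq0; rewrite subr_le0 ler_pdivrMr// mul1r ltW.
by apply: clip_eq1; rewrite lerBrDr ler_pdivlMr//; rewrite -natr1.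
Qed.

End metric.

Theorem theorem0p1 (R : realType) (G : groupType) (X : metricType R)
    (act : G -> X -> X) (S : set G) :
  countable [set: G] ->
  amenable R G ->
  compact [set: X] ->
  action_by_homeomorphisms act ->
  subsemigroup S ->
  ~ S 1%g ->
  (forall f : X -> R, continuous f ->
    closed_algebra_generated
      ([set f \o act s | s in S] `|` [set cst c | c in [set: R]]) f) ->
  forall F : nat -> {fset G}, folner (R := R) F ->
    topological_entropy (R := R) act F = 0%E.
Proof.
move=> _ _ Xc [_ actM acth] SS S1 generated F FF.
have actc g : continuous (act g) by have [? []] := acth g.
apply/eqP; rewrite eq_le; apply/andP; split; last first.
  apply: le_trans (ereal_sup_ubound _); last first.
    exists [set setT] => //; split; first by move=> _ ->; exact: openT.
    by apply/seteqP; split=> // x _; exists setT.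
  apply: limf_esup_ge0 => [|n]; first exact: filter_not_empty.
  by rewrite lee_fin divr_ge0// ln_cover_number_ge0.
apply: ge_ereal_sup => _ [U Ucov <-]; apply: limn_esup_le0 => e e0.
have [r [D DU]] := finite_bumps Xc Ucov.
(* The bumps are coded jointly by product codes, each one taking half of the exponent still
   available. *)
have bumps_coded (l : seq X) (d : R) : 0 < d -> \forall n \near \oo,
    coded act (F n) (fun x y => forall p, p \in l -> compatible (bump r p) x y)
      setT (expR (d * #|` F n|%:R)).
  elim: l d => [|p l IH] d d0.
    near=> n; have c1 := coded_true act (F n) setT (R := R).
    apply: coded_subrel (coded_le _ _ c1) => //.
    by rewrite -expR0 ler_expR mulr_ge0// ltW.
  have d2 : 0 < d / 2 by lra.
  have bump01 x : 0 <= bump r p x <= 1 by rewrite clip_ge0 clip_le1.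
  have := coded_eventually Xc actc actM SS S1 FF generated
    (@continuous_bump _ _ r p) bump01 d2.
  apply: filterS2 (IH _ d2) => n cl cp.
  rewrite (splitr d) mulrDl expRD.
  apply: coded_subrel (codedI cl cp) => x y [lxy pxy] q.
  by rewrite inE => /predU1P[->//|]; exact: lxy.
apply: filterS (bumps_coded (enum_fset D) e e0) => n.
move=> /(cover_number_le_coded DU) cn.
rewrite ler_pdivrMr; last by rewrite ltr0n cardfs_gt0; have [] := FF.
have [c0|c0] := leP (cover_number (cover_join act (F n) U) : R) 0.
  by rewrite ln0// mulr_ge0// ltW.
by rewrite -[leRHS]expRK ler_ln// posrE ?expR_gt0.
Unshelve. all: by end_near. Qed.
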